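(* Let $L$ be an odd positive integer, $A=\{1,L,L+1\}$, and let $n,d,e\in\mathbb{N}$ be such that both players are middle class, i.e. $M_1(n)\le d<U_1(n)$ and $M_2(n)\le e<U_2(n)$. Then the winner of $\mathrm{NIM}(A;n;d,e)$ is determined as follows. 1. $n\equiv 0,2,4,\dots,L-1,\,3L+3,3L+5,3L+7,\dots,4L\pmod{4L+2}$: - if $d<M_1(n)+\frac{L-1}{2}$, then $W(n;d,e)=2$; - for every integer $k\ge 0$, if $M_1(n)+\frac{L-1}{2}+Lk\le d<M_1(n)+\frac{L-1}{2}+L(k+1)$, then $W(n;d,e)=1$ when $e<M_2(n)+L(k+1)$, and $W(n;d,e)=2$ when $e\ge M_2(n)+L(k+1)$; - if $d\ge U_1(n)-\frac{L-1}{2}$, then $W(n;d,e)=1$. 2. $n\equiv 1,3,5,\dots,L,\,3L+4,3L+6,\dots,4L+1\pmod{4L+2}$: - for every integer $k\ge 0$, if $M_1(n)+Lk\le d<M_1(n)+L(k+1)$, then $W(n;d,e)=1$ when $e<M_2(n)+\frac{L-1}{2}+Lk$, and $W(n;d,e)=2$ when $e\ge M_2(n)+\frac{L-1}{2}+Lk$; - if $d\ge U_1(n)-L$, then $W(n;d,e)=1$ when $e<U_2(n)-\frac{L-1}{2}$, and $W(n;d,e)=2$ when $e\ge U_2(n)-\frac{L-1}{2}$. 3. $n\equiv L+1\pmod{4L+2}$: - if $d<M_1(n)+\frac{L-1}{2}$, then $W(n;d,e)=2$; - for every integer $k\ge 0$, if $M_1(n)+\frac{L-1}{2}+Lk\le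 d<M_1(n)+\frac{L-1}{2}+L(k+1)$, then $W(n;d,e)=1$ when $e<M_2(n)+L(k+1)$, and $W(n;d,e)=2$ when $e\ge M_2(n)+L(k+1)$; - if $d\ge U_1(n)-L$, then $W(n;d,e)=1$. 4. $n\equiv L+2,L+4,L+6,\dots,3L\pmod{4L+2}$: - for every integer $k\ge 0$, if $M_1(n)+Lk\le d<M_1(n)+L(k+1)$, then $W(n;d,e)=1$ when $e<M_2(n)+\frac{L-1}{2}+Lk$, and $W(n;d,e)=2$ when $e\ge M_2(n)+\frac{L-1}{2}+Lk$; - if $d\ge U_1(n)-\frac{L-1}{2}$, then $W(n;d,e)=1$. 5. $n\equiv L+3,L+5,\dots,3L+1\pmod{4L+2}$: - if $d<M_1(n)+\frac{L-1}{2}$, then $W(n;d,e)=2$; - for every integer $k\ge 0$, if $M_1(n)+\frac{L-1}{2}+Lk\le d<M_1(n)+\frac{L-1}{2}+L(k+1)$, then $W(n;d,e)=1$ when $e<M_2(n)+L(k+1)$, and $W(n;d,e)=2$ when $e\ge M_2(n)+L(k+1)$; - if $d\ge U_1(n)-L$, then $W(n;d,e)=1$ when $e<U_2(n)-\frac{L-1}{2}$, and $W(n;d,e)=2$ when $e\ge U_2(n)-\frac{L-1}{2}$. 6. $n\equiv 3L+2\pmod{4L+2}$: - for every integer $k\ge 0$, if $M_1(n)+Lk\le d<M_1(n)+L(k+1)$, then $W(n;d,e)=1$ when $e<M_2(n)+\frac{L-1}{2}+Lk$, and $W(n;d,e)=2$ when $e\ge M_2(n)+\frac{L-1}{2}+Lk$;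 - if $d\ge U_1(n)-L$, then $W(n;d,e)=1$.
   Context: $\mathbb{N}=\{0,1,2,\dots\}$. In the game $\mathrm{NIM}(A;n)$ two players alternate (Player 1 first) removing some $a\in A$ stones from a pile of $n$ stones ($a$ may not exceed the number of stones left); a player who cannot move loses. $W(n)\in\{1,2\}$ is the player with a winning strategy. In the NIM with Cash game $\mathrm{NIM}(A;n;d,e)$, Player 1 starts with $d$ dollars and Player 2 with $e$ dollars. Players alternate, Player 1 first; a move consists of removing some $a\in A$ stones and paying $a$ dollars, where $a$ may exceed neither the number of stones left nor the mover's money. A player who cannot move on his turn loses. $W(n;d,e)\in\{1,2\}$ is the player with a winning strategy. The upper class amounts $U_1(n),U_2(n)\in\mathbb{N}$ are defined recursively (depending on $A$): - If $n<\min(A)$, then $U_1(n)=U_2(n)=0$. - If $n\ge\min(A)$ and $W(n)=1$, then $U_1(n)=\min\{U_2(n-a)+a : a\in A,\ a\le n,\ W(n-a)=2\}$ and $U_2(n)=\max\{U_1(n-a): a\in A,\ a\le n\}$. - If $n\ge\min(A)$ and $W(n)=2$, then $U_2(n)=\max\{U_1(n-a): a\in A,\ a\le n\}$ and $U_1(n)=\min\{U_2(n-a)+a : a\in A,\ a\le n,\ U_1(n-a)=U_2(n)\}$. The middle class thresholds are $M_1(n)=\frac n2+1$, $M_2(n)=\frac n2$ for $n$ even, and $M_1(n)=M_2(n)=\frac{n+1}{2}$ for $n$ odd. Player $i$ is middle class when his money is at least $M_i(n)$ and less than $U_i(n)$. In each case the listed residues form arithmetic progressions of step $2$; a progression whose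 first term exceeds its last term is empty. *)

(* Defs.v *)
From HB Require Import structures.
From mathcomp Require Import all_boot.
From mathcomp Require Import boolp.

Set Implicit Arguments.
Unset Strict Implicit.
Unset Printing Implicit Defensive.

Variant player := Player1 | Player2.

Definition opponent (i : player) : player :=
  if i is Player1 then Player2 else Player1.

Definition is_player1 (i : player) : bool := if i is Player1 then true else false.
Definition player_of_bool (b : bool) : player := if b then Player1 else Player2.
Lemma is_player1K : cancel is_player1 player_of_bool. Proof. by case. Qed.
HB.instance Definition _ := Equality.copy player (can_type is_player1K).

(* Games in which a move consists in choosing a natural number and a player   *)
(* who cannot move on his turn loses.                                         *)
Record game := Game {
  position : Type;
  turn : position -> player;
  legal : position -> nat -> bool;
  after : position -> nat -> position
}.

(* [reachable i sigma p0 p]: the position [p] occurs in some play from [p0]   *)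
(* in which player [i] follows the strategy [sigma].                          *)
Inductive reachable (G : game) (i : player) (sigma : position G -> nat)
    (p0 : position G) : position G -> Prop :=
| reach_start : reachable i sigma p0 p0
| reach_own (p : position G) :
    reachable i sigma p0 p -> turn p = i -> legal p (sigma p) ->
    reachable i sigma p0 (after p (sigma p))
| reach_opponent (p : position G) (a : nat) :
    reachable i sigma p0 p -> turn p <> i -> legal p a ->
    reachable i sigma p0 (after p a).

(* Player [i] is never unable to move. All plays of the games below are       *)
(* finite as soon as [0 \notin A], so this means that he wins every play.     *)
Definition winning_strategy (G : game) (i : player) (p0 : position G)
    (sigma : position G -> nat) : Prop :=
  forall p, reachable i sigma p0 p -> turn p = i -> legal p (sigma p).

Definition has_winning_strategy (G : game) (i : player) (p0 : position G) :
    Prop :=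
  exists sigma : position G -> nat, winning_strategy i p0 sigma.

(* By [winner_has_winning_strategy], this is the only player having a winning *)
(* strategy when all plays are finite.                                        *)
Definition winner (G : game) (p0 : position G) : player :=
  if `[< has_winning_strategy Player1 p0 >] then Player1 else Player2.

Record nim_position := NimPosition { nim_turn : player; nim_stones : nat }.

Definition nim (A : seq nat) : game := {|
  position := nim_position;
  turn := nim_turn;
  legal := fun p a => (a \in A) && (a <= nim_stones p);
  after := fun p a => NimPosition (opponent (nim_turn p)) (nim_stones p - a)
|}.

Record cash_position := CashPosition {
  cash_turn : player;
  cash_stones : nat;
  cash_money : player -> nat
}.

Definition nim_with_cash (A : seq nat) : game := {|
  position := cash_position;
  turn := cash_turn;
  legal := fun p a =>
    [&& a \in A, a <= cash_stones p & a <= cash_money p (cash_turn p)];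
  after := fun p a =>
    CashPosition (opponent (cash_turn p)) (cash_stones p - a)
      (fun i => if i == cash_turn p then cash_money p i - a
                else cash_money p i)
|}.

Definition W (A : seq nat) (n : nat) : player :=
  @winner (nim A) (NimPosition Player1 n).

Definition W_cash (A : seq nat) (n d e : nat) : player :=
  @winner (nim_with_cash A)
    (CashPosition Player1 n (fun i => if i is Player1 then d else e)).

(* The minimum of a nonempty list. *)
Definition minl (s : seq nat) : nat := \big[minn/head 0 s]_(x <- s) x.
Definition maxl (s : seq nat) : nat := \max_(x <- s) x.

(* The pair [(U1 n, U2 n)]; the recursion is on the fuel [k], and [k = n]     *)
(* suffices when [0 \notin A] (see [UE]).                                     *)
Fixpoint U_fuel (A : seq nat) (k n : nat) : nat * nat :=
  if k is k'.+1 then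
    let V1 m := (U_fuel A k' m).1 in
    let V2 m := (U_fuel A k' m).2 in
    let u2 := maxl [seq V1 (n - a) | a <- A & a <= n] in
    if n < minl A then (0, 0)
    else if W A n == Player1 then
      (minl [seq V2 (n - a) + a | a <- A & (a <= n) && (W A (n - a) == Player2)],
       u2)
    else
      (minl [seq V2 (n - a) + a | a <- A & (a <= n) && (V1 (n - a) == u2)],
       u2)
  else (0, 0).

Definition U1 (A : seq nat) (n : nat) : nat := (U_fuel A n n).1.
Definition U2 (A : seq nat) (n : nat) : nat := (U_fuel A n n).2.

Definition M1 (n : nat) : nat := if odd n then (n + 1) %/ 2 else n %/ 2 + 1.
Definition M2 (n : nat) : nat := if odd n then (n + 1) %/ 2 else n %/ 2.

(* The arithmetic progression a, a + 2, ... bounded by b; empty if b < a. *)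
Definition progression2 (a b : nat) : seq nat :=
  [seq x <- index_iota a b.+1 | ~~ odd (x - a)].

Lemma minl_mem (s : seq nat) : s != [::] -> minl s \in s.
Proof.
case: s => // x s _; rewrite /minl /=.
have H t : \big[minn/x]_(y <- t) y \in x :: t.
  elim: t => [|y t IH]; first by rewrite big_nil mem_head.
  rewrite big_cons !inE /minn; case: ifP => _; first by rewrite eqxx orbT.
  by move: IH; rewrite inE => /orP[->|->]; rewrite ?orbT.
by have := H (x :: s); rewrite !inE; case/or3P => ->; rewrite ?orbT.
Qed.

Lemma minl_le (s : seq nat) (x : nat) : x \in s -> minl s <= x.
Proof.
rewrite /minl; move: (head 0 s) => d; elim: s => // y s IH.
rewrite inE big_cons geq_min => /orP[/eqP->|/IH->]; by rewrite ?leqnn ?orbT.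
Qed.

Lemma U_fuelE (A : seq nat) (k l n : nat) : 0 \notin A -> n <= k -> n <= l ->
  U_fuel A k n = U_fuel A l n.
Proof.
move=> A0; have minA0 : A = [::] \/ 0 < minl A.
  have [->|An] := eqVneq A [::]; first by left.
  right; rewrite lt0n; apply: contraNneq A0 => <-; exact: minl_mem.
elim: k l n => [|k IH] [|l] n.
- by [].
- rewrite leqn0 => /eqP-> _ /=; case: minA0 => [->|->//].
  by rewrite /minl /maxl /= !big_nil; case: ifP => //; case: ifP.
- move=> _; rewrite leqn0 => /eqP-> /=; case: minA0 => [->|->//].
  by rewrite /minl /maxl /= !big_nil; case: ifP => //; case: ifP.
move=> nk nl.
have E a : a \in A -> a <= n -> U_fuel A k (n - a) = U_fuel A l (n - a).
  move=> aA an; have a0 : 0 < a by rewrite lt0n; apply: contraNneq A0 => <-.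
  by apply: IH; rewrite leq_subLR (leq_trans _ (leq_add a0 (leqnn _))).
have Eu : [seq (U_fuel A k (n - a)).1 | a <- A & a <= n] =
          [seq (U_fuel A l (n - a)).1 | a <- A & a <= n].
  by apply/eq_in_map => a; rewrite mem_filter => /andP[an aA]; rewrite E.
rewrite /= Eu; case: ifP => // _; case: ifP => _; congr (minl _, _).
  by apply/eq_in_map => a; rewrite mem_filter => /andP[/andP[an _] aA]; rewrite E.
set u2 := maxl _.
have -> : [seq a <- A | (a <= n) && ((U_fuel A k (n - a)).1 == u2)] =
          [seq a <- A | (a <= n) && ((U_fuel A l (n - a)).1 == u2)].
  by apply/eq_in_filter => a aA; case: leqP => //= an; rewrite E.
by apply/eq_in_map => a; rewrite mem_filter => /andP[/andP[an _] aA]; rewrite E.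
Qed.

(* The defining recursion of the upper class amounts. *)
Lemma UE (A : seq nat) (n : nat) : 0 \notin A ->
  (U1 A n, U2 A n) =
    let u2 := maxl [seq U1 A (n - a) | a <- A & a <= n] in
    if n < minl A then (0, 0)
    else if W A n == Player1 then
      (minl [seq U2 A (n - a) + a |
               a <- A & (a <= n) && (W A (n - a) == Player2)], u2)
    else
      (minl [seq U2 A (n - a) + a |
               a <- A & (a <= n) && (U1 A (n - a) == u2)], u2).
Proof.
move=> A0; rewrite /U1 /U2 -surjective_pairing.
rewrite (@U_fuelE A n n.+1 n) //=.
have E a : U_fuel A n (n - a) = U_fuel A (n - a) (n - a).
  by apply: U_fuelE => //; exact: leq_subr.
have -> : [seq (U_fuel A n (n - a)).1 | a <- A & a <= n] =
          [seq (U_fuel A (n - a) (n - a)).1 | a <- A & a <= n].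
  by apply: eq_map => a; rewrite E.
case: ifP => // _; case: ifP => _; congr (minl _, _).
  by apply: eq_map => a; rewrite E.
set u2 := maxl _.
have -> : [seq a <- A | (a <= n) && ((U_fuel A n (n - a)).1 == u2)] =
          [seq a <- A | (a <= n) && ((U_fuel A (n - a) (n - a)).1 == u2)].
  by apply: eq_filter => a; rewrite E.
by apply: eq_map => a; rewrite E.
Qed.

Section Determinacy.
Variables (G : game) (size_of : position G -> nat).
Hypothesis turn_after : forall (p : position G) a,
  turn (after p a) = opponent (turn p).
Hypothesis size_after : forall (p : position G) a,
  legal p a -> size_of (after p a) < size_of p.

Fixpoint mover_wins (k : nat) (p : position G) : Prop :=
  if k is k'.+1 then exists a, legal p a /\ ~ mover_wins k' (after p a)
  else False.

Lemma mover_wins_fuel (k l : nat) (p : position G) :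
  size_of p < k -> size_of p < l -> mover_wins k p <-> mover_wins l p.
Proof.
elim: k l p => [|k IH] [|l] p //= pk pl.
split=> -[a [pa Na]]; exists a; split=> // Ha; apply: Na;
  have sa := size_after pa.
  by apply/(IH l) => //; exact: leq_trans sa _.
by apply/(IH l) => //; exact: leq_trans sa _.
Qed.

Lemma mover_winsE (p : position G) :
  mover_wins (size_of p).+1 p <->
  exists a, legal p a /\ ~ mover_wins (size_of (after p a)).+1 (after p a).
Proof.
split=> -[a [pa Na]]; exists a; split=> // Ha; apply: Na;
  have sa := size_after pa.
  by apply/(@mover_wins_fuel _ (size_of (after p a)).+1).
by apply/(@mover_wins_fuel _ (size_of p)).
Qed.

Lemma opponentP (i j : player) : j <> i -> opponent j = i.
Proof. by case: i j => [] []. Qed.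

Lemma opponent_neq (i : player) : opponent i <> i.
Proof. by case: i. Qed.

Lemma has_winning_strategyP (i : player) (p : position G) :
  has_winning_strategy i p <->
  (turn p = i <-> mover_wins (size_of p).+1 p).
Proof.
pose wins q := mover_wins (size_of q).+1 q.
split; last first.
  move=> pi.
  pose good q a := legal q a /\ ~ wins (after q a).
  pose sigma q := if pselect (exists a, good q a) is left H
                  then projT1 (cid H) else 0.
  have sigmaP q : wins q -> good q (sigma q).
    move=> /mover_winsE Hq; rewrite /sigma; case: pselect => // H.
    exact: projT2 (cid H).
  exists sigma.
  have inv q : reachable i sigma p q -> (turn q = i <-> wins q).
    elim=> {q} // [q _ IH qi _|q a _ IH qi qa]; rewrite turn_after.
      split=> [|/(proj2 (sigmaP q (proj1 IH qi)))//].
      by rewrite qi => /opponent_neq.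
    split=> // _; last exact: opponentP.
    by apply: contrapT => Na; apply: qi; apply/IH/mover_winsE; exists a.
  by move=> q Rq qi; case: (sigmaP q (proj1 (inv q Rq) qi)).
case=> sigma; have [m] := ubnP (size_of p); elim: m p => // m IH p pm Hp.
have next a q : q = after p a -> legal p a -> reachable i sigma p q ->
    turn q = i <-> wins q.
  move=> -> pa Ra; apply: IH; first exact: leq_trans (size_after pa) _.
  move=> r Rr; apply: Hp.
  elim: Rr => // [s _ Rs si sl|s b _ Rs si sl]; first exact: reach_own.
  exact: reach_opponent.
split=> [pi|/mover_winsE[a [pa Na]]].
  have pl := Hp p (reach_start _ _ _) pi.
  apply/mover_winsE; exists (sigma p); split=> // /(next (sigma p)).
  rewrite turn_after pi => /(_ erefl pl) H; apply: (@opponent_neq i).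
  by apply: H; exact: (reach_own (reach_start _ _ _)).
apply: contrapT => npi; apply: Na; apply/(next a) => //.
  exact: (reach_opponent (reach_start _ _ _)).
by rewrite turn_after; exact: opponentP.
Qed.

Lemma winner_has_winning_strategy (i : player) (p : position G) :
  winner p = i <-> has_winning_strategy i p.
Proof.
rewrite /winner; case: asboolP => H; move: (H).
all: rewrite !has_winning_strategyP.
all: case: i; case: (turn p); case: (pselect (mover_wins (size_of p).+1 p)).
all: by split => //; intuition congruence.
Qed.

End Determinacy.

Lemma W_spec (A : seq nat) (n : nat) (i : player) : 0 \notin A ->
  W A n = i <-> @has_winning_strategy (nim A) i (NimPosition Player1 n).
Proof.
move=> A0; apply: (@winner_has_winning_strategy (nim A) nim_stones) => //=.
move=> p a /andP[aA an].
have a0 : 0 < a by rewrite lt0n; apply: contraNneq A0 => <-.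
by rewrite ltn_subrL a0 (leq_trans a0).
Qed.

Lemma W_cash_spec (A : seq nat) (n d e : nat) (i : player) : 0 \notin A ->
  W_cash A n d e = i <->
  @has_winning_strategy (nim_with_cash A) i
    (CashPosition Player1 n (fun j => if j is Player1 then d else e)).
Proof.
move=> A0.
apply: (@winner_has_winning_strategy (nim_with_cash A) cash_stones) => //=.
move=> p a /and3P[aA an _].
have a0 : 0 < a by rewrite lt0n; apply: contraNneq A0 => <-.
by rewrite ltn_subrL a0 (leq_trans a0).
Qed.

(* Main.v *)
Require Import Defs.
From mathcomp Require Import all_boot.
From mathcomp Require Import boolp.
From mathcomp Require Import zify.

(* Write L = 2h + 1. If the mover has his upper class amount and so has his
   opponent, the winner is that of plain NIM. Otherwise everything is decided
   by an explicit staircase [mid] of steps of length L, which satisfies the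
   recursion of winning positions, the single stone being always the best move
   on it. The two descriptions fit together because U2(n) = U1(n - 1) and
   because [mid] holds when only the mover is upper class and fails when only
   his opponent is. Both facts come from the closed form
   U1(n) = uphalf (n + L * floor((n + L) / (2L + 1))), itself obtained by
   induction along the (2L + 1)-periodic solution of plain NIM. *)

Set Implicit Arguments.
Unset Strict Implicit.
Unset Printing Implicit Defensive.

Lemma neq_player1 (i : player) : i <> Player1 <-> i = Player2.
Proof. by case: i. Qed.

(** * Winning positions of both games as recursions on [W] and [W_cash] *)

Section Recursion.
Variable A : seq nat.
Hypothesis A0 : 0 \notin A.

Lemma mem_gt0 (a : nat) : a \in A -> 0 < a.
Proof. by move=> aA; rewrite lt0n; apply: contraNneq A0 => <-. Qed.

Lemma nim_stones_after (p : position (nim A)) (a : nat) :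
  legal p a -> nim_stones (after p a) < nim_stones p.
Proof. by case: p => i n /= /andP[/mem_gt0]; lia. Qed.

Lemma cash_stones_after (p : position (nim_with_cash A)) (a : nat) :
  legal p a -> cash_stones (after p a) < cash_stones p.
Proof. by case: p => i n f /= /and3P[/mem_gt0]; lia. Qed.

Definition nim_wins (p : position (nim A)) : Prop :=
  mover_wins (nim_stones p).+1 p.

Definition cash_wins (p : position (nim_with_cash A)) : Prop :=
  mover_wins (cash_stones p).+1 p.

Lemma nim_winsE (p : position (nim A)) :
  nim_wins p <-> exists a, legal p a /\ ~ nim_wins (after p a).
Proof. exact: mover_winsE nim_stones_after p. Qed.

Lemma cash_winsE (p : position (nim_with_cash A)) :
  cash_wins p <-> exists a, legal p a /\ ~ cash_wins (after p a).
Proof. exact: mover_winsE cash_stones_after p. Qed.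

(** [W] always lets [Player1] start, whereas a move hands the turn to [Player2]; this permits
    renaming the players after each move. *)
Lemma nim_wins_turn (i j : player) (n : nat) :
  nim_wins (NimPosition i n) <-> nim_wins (NimPosition j n).
Proof.
have [m] := ubnP n; elim: m n i j => // m IH n i j nm.
rewrite !nim_winsE /=; split=> -[a [aP Na]]; exists a; split=> //=;
  by rewrite IH; [exact: Na|have /andP[/mem_gt0] := aP; lia].
Qed.

(** Letting the next mover be called [Player1] again interchanges the two purses, hence the order
    [e], [d - a] in [W_cash_Player1]. Asking only for equal values at mover and opponent avoids
    function extensionality. *)
Lemma cash_wins_money (i j : player) (n : nat) (f g : player -> nat) :
  f i = g j -> f (opponent i) = g (opponent j) ->
  cash_wins (CashPosition i n f) <-> cash_wins (CashPosition j n g).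
Proof.
have [m] := ubnP n; elim: m n i j f g => // m IH n i j f g nm own opp.
have E a : a \in A -> a <= n ->
    cash_wins (@after (nim_with_cash A) (CashPosition i n f) a) <->
    cash_wins (@after (nim_with_cash A) (CashPosition j n g) a).
  move=> /mem_gt0 a0 an; apply: IH => /=; first lia.
    by move: own opp; case: i; case: j => /= own opp; rewrite ?own ?opp.
  by move: own opp; case: i; case: j => /= own opp; rewrite ?own ?opp.
rewrite !cash_winsE /= own.
by split=> -[a [aP Na]]; exists a; split=> //; have /and3P[aA an _] := aP;
  move=> /(E a aA an).
Qed.

Lemma W_Player1 (n : nat) :
  W A n = Player1 <-> exists2 a, a \in A & a <= n /\ W A (n - a) = Player2.
Proof.
have E m : W A m = Player1 <-> nim_wins (NimPosition Player1 m).
  rewrite W_spec //.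
  rewrite (@has_winning_strategyP (nim A) nim_stones _ nim_stones_after) //=.
  by split=> // H; apply/H.
rewrite E nim_winsE; split=> [[a [/andP[aA an] /= Na]]|[a aA [an Wa]]].
  exists a => //; split=> //; apply/neq_player1 => /E; move: Na.
  by rewrite (nim_wins_turn Player2 Player1).
exists a; split; first exact/andP.
by move=> /(nim_wins_turn Player2 Player1)/E; rewrite Wa.
Qed.

Lemma W_Player2 (n a : nat) :
  W A n = Player2 -> a \in A -> a <= n -> W A (n - a) = Player1.
Proof.
move=> Wn aA an; case Wa: (W A (n - a)) => //.
have: W A n = Player1 by apply/W_Player1; exists a.
by rewrite Wn.
Qed.

Lemma W_cash_Player1 (n d e : nat) :
  W_cash A n d e = Player1 <->
  exists2 a, a \in A &
    [/\ a <= n, a <= d & W_cash A (n - a) e (d - a) = Player2].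
Proof.
have E m x y : W_cash A m x y = Player1 <->
    cash_wins (CashPosition Player1 m (fun i => if i is Player1 then x else y)).
  rewrite W_cash_spec //.
  rewrite (@has_winning_strategyP (nim_with_cash A) cash_stones _
    cash_stones_after) //=.
  by split=> // H; apply/H.
rewrite E cash_winsE; split=> [[a [/and3P[aA an ad] /= Na]]|[a aA [an ad Wa]]].
  exists a => //; split=> //; apply/neq_player1 => /E H; apply: Na.
  by move: H; apply: (iffLR (cash_wins_money _ _ _)).
exists a; split; first exact/and3P.
move=> H; suff: W_cash A (n - a) e (d - a) = Player1 by rewrite Wa.
by apply/E; move: H; apply: (iffLR (cash_wins_money _ _ _)).
Qed.

End Recursion.

(** * Upper class amounts and a criterion for the winner, for any [A] containing 1 *)

Section UpperClass.
Variable A : seq nat.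
Hypotheses (A0 : 0 \notin A) (A1 : 1 \in A).

Lemma U_rec (n : nat) : 0 < n ->
  U2 A n = maxl [seq U1 A (n - a) | a <- A & a <= n] /\
  U1 A n = if W A n == Player1 then
      minl [seq U2 A (n - a) + a |
              a <- A & (a <= n) && (W A (n - a) == Player2)]
    else
      minl [seq U2 A (n - a) + a |
              a <- A & (a <= n) && (U1 A (n - a) == U2 A n)].
Proof.
move=> n0; have := UE n A0; have := minl_le A1.
case: ltnP => [|_ _] /=; first lia.
by case: ifP => _ [-> ->].
Qed.

Lemma U1_le_U2 (n a : nat) : a \in A -> a <= n -> U1 A (n - a) <= U2 A n.
Proof.
move=> aA an; have a0 := mem_gt0 A0 aA.
have [|-> _] := @U_rec n; first lia.
rewrite /maxl big_map.
by rewrite (big_rem a) ?leq_maxl // mem_filter an.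
Qed.

Lemma U2_attained (n : nat) : 0 < n ->
  exists2 a, a \in A & a <= n /\ U2 A n = U1 A (n - a).
Proof.
move=> n0; have [-> _] := U_rec n0; rewrite /maxl.
set s := map _ _.
have: s != [::].
  apply/eqP => /(congr1 (fun t => U1 A (n - 1) \in t)).
  by rewrite (map_f (fun a => U1 A (n - a))) // mem_filter n0.
have smax : s != [::] -> \max_(x <- s) x \in s.
  elim: s => // x [|y s] IH _; first by rewrite big_seq1 mem_head.
  rewrite big_cons inE /maxn; case: ifP => _; last by rewrite eqxx.
  by rewrite IH ?orbT.
move=> /smax/mapP[a]; rewrite mem_filter => /andP[an aA] ->.
by exists a.
Qed.

Lemma U1_le_Player1 (n a : nat) :
  W A n = Player1 -> a \in A -> a <= n -> W A (n - a) = Player2 ->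
  U1 A n <= U2 A (n - a) + a.
Proof.
move=> Wn aA an Wa; have a0 := mem_gt0 A0 aA.
have [|_ ->] := @U_rec n; first lia.
rewrite Wn eqxx; apply: minl_le.
by apply: (map_f (fun a => U2 A (n - a) + a)); rewrite mem_filter an Wa eqxx.
Qed.

Lemma U1_attained_Player1 (n : nat) : W A n = Player1 ->
  exists2 a, a \in A &
    [/\ a <= n, W A (n - a) = Player2 & U1 A n = U2 A (n - a) + a].
Proof.
move=> Wn; have /(W_Player1 A0)[b bA [bn Wb]] := Wn.
have b0 := mem_gt0 A0 bA; have [|_ ->] := @U_rec n; first lia.
rewrite Wn eqxx; set s := map _ _.
have: s != [::].
  apply/eqP => /(congr1 (fun t => U2 A (n - b) + b \in t)).
  by rewrite (map_f (fun a => U2 A (n - a) + a)) // mem_filter bn Wb.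
move=> /minl_mem/mapP[a]; rewrite mem_filter => /andP[/andP[an /eqP Wa] aA] ->.
by exists a.
Qed.

Lemma U1_attained_Player2 (n : nat) : 0 < n -> W A n = Player2 ->
  exists2 a, a \in A &
    [/\ a <= n, U1 A (n - a) = U2 A n & U1 A n = U2 A (n - a) + a].
Proof.
move=> n0 Wn; have [b bA [bn Ub]] := U2_attained n0.
have [_ ->] := U_rec n0; rewrite Wn /=; set s := map _ _.
have: s != [::].
  apply/eqP => /(congr1 (fun t => U2 A (n - b) + b \in t)).
  by rewrite (map_f (fun a => U2 A (n - a) + a)) // mem_filter bn -Ub eqxx.
move=> /minl_mem/mapP[a]; rewrite mem_filter => /andP[/andP[an /eqP Ua] aA] ->.
by exists a.
Qed.

(* When only the mover is upper class and [mid] holds, removing one stone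
   keeps the opponent below his upper class amount, as U2(n) = U1(n - 1): so
   [mid] still rules the next position. *)
Lemma W_cash_mid (mid : nat -> nat -> nat -> Prop)
    (U2_pred : forall n, 0 < n -> U2 A n = U1 A (n - 1))
    (mid_move1 : forall n d e, 0 < n -> mid n d e ->
       0 < d /\ ~ mid (n - 1) e (d - 1))
    (mid_move : forall n d e a, a \in A -> a <= n -> a <= d -> ~ mid n d e ->
       mid (n - a) e (d - a))
    (mid_poor : forall n d e, d < U1 A n -> U2 A n <= e -> ~ mid n d e)
    (mid_rich : forall n d e, U1 A n <= d -> e < U2 A n -> mid n d e)
    (n d e : nat) :
  W_cash A n d e = Player1 <->
  if (U1 A n <= d) && (U2 A n <= e) then W A n = Player1 else mid n d e.
Proof.
have [m] := ubnP n; elim: m n d e => // m IH n d e nm.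
have opponent_wins a : a \in A -> a <= n ->
    (if (U1 A (n - a) <= e) && (U2 A (n - a) <= d - a)
     then W A (n - a) = Player1 else mid (n - a) e (d - a)) ->
    W_cash A (n - a) e (d - a) = Player2 -> False.
  move=> aA an /IH H Wa; have := mem_gt0 A0 aA => a0.
  by have := H ltac:(lia); rewrite Wa.
rewrite W_cash_Player1 //; case: ifP => [/andP[dU eU]|rich].
  split=> [[a aA [an ad Wa]]|Wn].
    (* If plain NIM is lost, the opponent is still upper class after the move, as
       [U1 (n - a) <= U2 n <= e]: he wins by plain NIM, or by [mid_rich] if he alone is upper
       class. *)
    case Wn: (W A n) => //; case: (opponent_wins a aA an _ Wa).
    have Wna := W_Player2 A0 Wn aA an; have := U1_le_U2 aA an.
    case: ifP => // H1 H2; apply: mid_rich; lia.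
  (* The winning move of NIM that attains [U1 n] leaves the mover at least [U2 (n - a)], so both
     players remain upper class. *)
  have [a aA [an Wa Ua]] := U1_attained_Player1 Wn; exists a => //.
  split=> //; first lia.
  apply/neq_player1 => /IH; have := mem_gt0 A0 aA => a0.
  have := U1_le_U2 aA an => Ule /(_ ltac:(lia)).
  by case: ifP => [_|]; [rewrite Wa | lia].
split=> [[a aA [an ad Wa]]|Mn].
  apply: contrapT => Nm; case: (opponent_wins a aA an _ Wa).
  case: ifP => [/andP[eU dU]|_]; last exact: mid_move.
  case Wna: (W A (n - a)) => //.
  (* Here [a] wins plain NIM and leaves at least [U2 (n - a)], so [U1 n <= d]; then only the
     opponent can be below his amount, which is the case of [mid_rich]. *)
  have Wn : W A n = Player1 by apply/(W_Player1 A0); exists a.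
  have := U1_le_Player1 Wn aA an Wna => Ule.
  by exfalso; apply: Nm; apply: mid_rich; lia.
(* Otherwise the mover alone would be below his amount, and [mid_poor] would refute [mid]. *)
have eU : e < U2 A n.
  rewrite ltnNge; apply/negP => eU; case: (mid_poor n d e _ eU Mn).
  by move: rich; rewrite eU andbT; lia.
have n0 : 0 < n by case: n eU {nm rich Mn opponent_wins}.
have [d0 Nm] := mid_move1 n d e n0 Mn.
have n1m : n - 1 < m by lia.
exists 1 => //; split=> //; apply/neq_player1 => /(IH _ _ _ n1m).
by move: eU; rewrite U2_pred //; case: ifP => // /andP[]; lia.
Qed.

End UpperClass.

Lemma parity_cases (n : nat) :
  (exists m, n = 2 * m) \/ (exists m, n = 2 * m + 1).
Proof. by case: (boolP (odd n)) => ?; [right|left]; exists n./2; lia. Qed.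

(** * The staircase [mid] for the moves 1, L, L + 1, and its stability under moves *)

Section Middle.
Variables L h : nat.
Hypothesis hL : L = 2 * h + 1.
Let A := [:: 1; L; L + 1].
Let P := 4 * h + 3.

(* [d] and [e] are the money of the player to move and of his opponent. The
   first disjunct covers a mover or an opponent below the middle class. *)
Definition mid (n d e : nat) : Prop :=
  (e < d) && (e < M2 n) \/
  exists k, if odd n then (M1 n + L * k <= d) && (e < M2 n + h + L * k)
            else (M1 n + h + L * k <= d) && (e < M2 n + L * (k + 1)).

Lemma mid_even (m d e : nat) : mid (2 * m) d e <->
  (e < d) && (e < m) \/
  exists k, (m + h + L * k < d) && (e < m + L * k + L).
Proof.
rewrite /mid /M1 /M2 (_ : odd (2 * m) = false); last lia.
rewrite (_ : 2 * m %/ 2 = m); last lia.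
by split=> -[H|[k H]]; [left|right; exists k; lia|left|right; exists k; lia].
Qed.

Lemma mid_odd (m d e : nat) : mid (2 * m + 1) d e <->
  (e < d) && (e <= m) \/
  exists k, (m + L * k < d) && (e <= m + h + L * k).
Proof.
rewrite /mid /M1 /M2 (_ : odd (2 * m + 1) = true); last lia.
rewrite (_ : (2 * m + 1 + 1) %/ 2 = m + 1); last lia.
split=> -[H|[k H]]; [left|right; exists k|left|right; exists k]; lia.
Qed.

(** [L * k] is opaque to [lia]; this supplies the fact that distinct steps are at least [L]
    apart. *)
Lemma leq_mul_dichotomy (k l : nat) : L * k <= L * l \/ L * l + L <= L * k.
Proof.
have [kl|lk] := leqP k l; first by left; rewrite leq_mul2l kl orbT.
by right; rewrite -mulnSr leq_mul2l lk orbT.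
Qed.

Lemma div_below (x : nat) : exists k, L * k <= x < L * k + L.
Proof.
by exists (x %/ L); have := divn_eq x L; have : 0 < L; [lia|];
  move=> /(ltn_pmod x); lia.
Qed.

Lemma mem_moves (a : nat) : a \in A -> [\/ a = 1, a = L | a = L + 1].
Proof.
by rewrite !inE => /or3P[] /eqP; [constructor 1|constructor 2|constructor 3].
Qed.

(** The staircases for piles [n] and [n - 1] interlock: if the mover stands on step [k] and the
    opponent afterwards on step [l], the bounds on the two purses force both a strict inequality
    between [k] and [l] and the reverse weak one. *)
Lemma mid_move1 (n d e : nat) :
  0 < n -> mid n d e -> 0 < d /\ ~ mid (n - 1) e (d - 1).
Proof.
have [[m ->]|[m ->]] := parity_cases n => n0.
  rewrite (_ : 2 * m - 1 = 2 * (m - 1) + 1) ?mid_even ?mid_odd; last lia.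
  case=> [H1|[k H1]]; (split; first lia); case=> [H2|[l H2]]; try lia.
  have := leq_mul_dichotomy l k; lia.
rewrite addnK mid_even mid_odd.
case=> [H1|[k H1]]; (split; first lia); case=> [H2|[l H2]]; try lia.
have := leq_mul_dichotomy k l; lia.
Qed.

(** The money [e] alone selects the opponent's step, through [div_below]. That the mover fails on
    the matching step of his own staircase bounds [d] from above, which is the other half of that
    step. An opponent too poor for any step falls under the first disjunct of [mid]. *)
Lemma mid_move (n d e a : nat) : a \in A -> a <= n -> a <= d ->
  ~ mid n d e -> mid (n - a) e (d - a).
Proof.
have [[m ->]|[m ->]] := parity_cases n.
  rewrite mid_even => /mem_moves aA an ad Nm.
  have Nm0 : ~ (e < d) && (e < m) by move=> ?; apply: Nm; left.
  have Nmk k : ~ (m + h + L * k < d) && (e < m + L * k + L).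
    by move=> ?; apply: Nm; right; exists k.
  case: aA an ad => -> an ad.
  - rewrite (_ : 2 * m - 1 = 2 * (m - 1) + 1) ?mid_odd; last lia.
    have [em|me] := ltnP e m; first by left; lia.
    have [k kP] := div_below (e - m).
    by right; exists k; have := Nmk k; lia.
  - rewrite (_ : 2 * m - L = 2 * (m - h - 1) + 1) ?mid_odd; last lia.
    have [em|me] := ltnP e (m - h); first by left; lia.
    have [k kP] := div_below (e - (m - h)).
    right; exists k; have := Nmk k; have := Nmk (k - 1).
    by case: k kP => [|k] kP; rewrite ?subn1 /= ?mulnS; lia.
  - rewrite (_ : 2 * m - (L + 1) = 2 * (m - h - 1)) ?mid_even; last lia.
    have [em|me] := ltnP e m; first by left; lia.
    have [k kP] := div_below (e - m).
    by right; exists k; have := Nmk k; lia.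
rewrite mid_odd => /mem_moves aA an ad Nm.
have Nm0 : ~ (e < d) && (e <= m) by move=> ?; apply: Nm; left.
have Nmk k : ~ (m + L * k < d) && (e <= m + h + L * k).
  by move=> ?; apply: Nm; right; exists k.
case: aA an ad => -> an ad.
- rewrite addnK mid_even.
  have [em|me] := leqP e (m + h).
    by left; have := Nmk 0; lia.
  have [k kP] := div_below (e - (m + h + 1)).
  (* Step [k] of the even pile matches step [k + 1] of the odd one: [e] lies under the bound of that
     step, so [d] misses its threshold. *)
  by right; exists k; have := Nmk k; have := Nmk (k + 1); lia.
- rewrite (_ : 2 * m + 1 - L = 2 * (m - h)) ?mid_even; last lia.
  have [em|me] := leqP e m; first by left; lia.
  have [k kP] := div_below (e - (m + 1)).
  right; exists k; have := Nmk k; have := Nmk (k + 1); lia.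
- rewrite (_ : 2 * m + 1 - (L + 1) = 2 * (m - h - 1) + 1) ?mid_odd; last lia.
  have [em|me] := ltnP e (m - h); first by left; have := Nmk 0; lia.
  have [k kP] := div_below (e - (m - h)).
  right; exists k; have := Nmk k; lia.
Qed.


(** * Plain NIM and the closed form of the upper class amounts *)

Lemma A_gt0 : 0 \notin A.
Proof. by rewrite !inE; lia. Qed.

(* [s] is the residue of the pile modulo [P], that is modulo [2 * L + 1]. *)
Definition losing (s : nat) : bool := ~~ odd s && (s < L).

Lemma sub_divn (n a q s : nat) : n = P * q + s -> s < P -> a <= n -> a <= P ->
  exists p t, [/\ n - a = P * p + t, t < P &
    (q = p /\ s = t + a) \/ (q = p.+1 /\ s + P = t + a)].
Proof.
move=> nE sP an aP; have [as_|sa] := leqP a s.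
  by exists q, (s - a); split; lia.
case: q nE => [|q] nE; first lia.
exists q, (s + P - a); split; lia.
Qed.

Lemma divn_P (n : nat) : exists q s, n = P * q + s /\ s < P.
Proof.
exists (n %/ P), (n %% P); split; last by rewrite ltn_mod /P; lia.
by rewrite mulnC -divn_eq.
Qed.

(** From an odd residue below [L] remove 1, from another odd one [L], from an even one above [L]
    remove [L + 1]: all reach an even residue below [L]. From the latter, one stone leads to an odd
    residue or to [2 * L], and the other moves to a residue at least [L]. *)
Lemma W_losing (q s : nat) :
  s < P -> W A (P * q + s) = if losing s then Player2 else Player1.
Proof.
have [m] := ubnP (P * q + s); elim: m q s => // m IH q s nm sP.
have sub a : a \in A -> a <= P * q + s -> exists t,
    W A (P * q + s - a) = (if losing t then Player2 else Player1) /\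
    t < P /\ (s = t + a \/ 0 < q /\ s + P = t + a).
  move=> aA an; have a0 := mem_gt0 A_gt0 aA.
  have aP : a <= P by case: (mem_moves aA) => ->; lia.
  have [p [t [nE tP qs]]] := sub_divn erefl sP an aP.
  exists t; rewrite nE IH //; last lia.
  by split=> //; split=> //; lia.
case: ifP => ls; last first.
  apply/(W_Player1 A_gt0).
  have win a : a \in A -> a <= s -> losing (s - a) ->
      exists2 a, a \in A & a <= P * q + s /\ W A (P * q + s - a) = Player2.
    move=> aA as_ lsa; exists a => //.
    split; first lia.
    have [|t [-> [tP st]]] := sub a aA; first lia.
    by rewrite (_ : t = s - a) ?lsa //; lia.
  have [sL|Ls] := ltnP s L.
    by apply: (win 1); rewrite ?inE ?eqxx // ?/losing; move: ls;
      rewrite /losing; lia.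
  case so: (odd s).
    by apply: (win L); rewrite ?inE ?eqxx ?orbT // /losing; move: so; lia.
  apply: (win (L + 1)); rewrite ?inE ?eqxx ?orbT //; move: so ls;
    by rewrite /losing /P in sP *; lia.
apply/neq_player1 => /(W_Player1 A_gt0)[a aA [an]].
have [t [-> [tP st]]] := sub a aA an.
case: ifP => // + _; move: ls; rewrite /losing.
by case: (mem_moves aA) st => ->; lia.
Qed.

(** A full period of [2 * L + 1] stones contributes half of [P + L], which is [3 * h + 2]; inside a
    period a jump by [L] under [uphalf] occurs just after residue [L]. *)
Definition upper (n : nat) : nat :=
  let s := n %% P in
  (3 * h + 2) * (n %/ P) + uphalf (if s <= L then s else s + L).

Lemma upperE (q s : nat) : s < P -> upper (P * q + s) =
  (3 * h + 2) * q + uphalf (if s <= L then s else s + L).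
Proof. 
move=> sP; rewrite /upper (mulnC P) modnMDl modn_small // divnMDl; last lia.
by rewrite divn_small ?addn0.
 Qed.

Lemma upper_mono (m n : nat) : m <= n -> upper m <= upper n.
Proof.
elim: n => [|n IH]; first by case: m.
rewrite leq_eqVlt => /predU1P[-> //|/IH] /leq_trans; apply.
have [q [s [-> sP]]] := divn_P n.
have [sP1|sP1] := ltnP s.+1 P.
  by rewrite -addnS !upperE //; do 2!case: ifP => ?; lia.
rewrite (_ : (P * q + s).+1 = P * q.+1 + 0); last lia.
by rewrite !upperE //=; last lia; case: ifP => ?; lia.
Qed.

Lemma upper_pred (p t : nat) : t < P -> upper (P * p + t - 1) =
  if t is t'.+1 then (3 * h + 2) * p + uphalf (if t' <= L then t' else t' + L)
  else (3 * h + 2) * p.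
Proof.
case: t => [|t] tP; last first.
  by rewrite (_ : P * p + t.+1 - 1 = P * p + t) ?upperE; lia.
case: p => [|p]; first by rewrite !muln0 /upper mod0n div0n muln0.
rewrite (_ : P * p.+1 + 0 - 1 = P * p + (P - 1)); last lia.
by rewrite upperE; last lia; case: ifP; lia.
Qed.

(** These are the facts on the minimum defining [U1]. From a winning residue no winning move of NIM
    is cheaper than [upper]; one stone attains it if it wins NIM, and otherwise every winning move
    does. From a losing residue every move that maximizes [U1 (n - a)] attains it. *)
Lemma upper_move (q s p t a : nat) : a \in A -> s < P -> t < P ->
    q = p /\ s = t + a \/ q = p.+1 /\ s + P = t + a ->
  [/\ losing t -> upper (P * q + s) <= upper (P * p + t - 1) + a,
      losing t -> a = 1 \/ ~~ (losing (s - 1) && (0 < s)) ->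
        upper (P * q + s) = upper (P * p + t - 1) + a &
      losing s -> upper (P * p + t) = upper (P * q + s - 1) ->
        upper (P * q + s) = upper (P * p + t - 1) + a].
Proof.
move=> /mem_moves aA sP tP qs.
rewrite !upper_pred // !upperE // /losing.
case: t tP qs => [|t] tP qs; case: s sP qs => [|s] sP qs; rewrite /=.
- case: aA qs => ->; split; lia.
- case: aA qs => ->; split; do ?case: ifP => ?; lia.
- case: aA qs => ->; split; do ?case: ifP => ?; lia.
- case: aA qs => ->; split; do ?case: ifP => ?; lia.
Qed.

(** By strong induction: monotonicity of [upper] places the maximum defining [U2] at the removal of
    one stone, and [upper_move] evaluates the minimum defining [U1]. *)
Lemma U_upper (n : nat) : U1 A n = upper n /\ U2 A n = upper (n - 1).
Proof.
have [m] := ubnP n; elim: m n => // m IH n nm.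
have A1 : 1 \in A by rewrite mem_head.
have [n0|n0] := leqP n 0.
  have -> : n = 0 by lia.
  by rewrite sub0n /upper mod0n div0n muln0.
have U2n : U2 A n = upper (n - 1).
  apply/eqP; rewrite eqn_leq; apply/andP; split.
    have [a aA [an ->]] := U2_attained A_gt0 A1 n0.
    have a0 := mem_gt0 A_gt0 aA.
    have [|-> _] := IH (n - a); first lia.
    by apply: upper_mono; lia.
  have [|<- _] := IH (n - 1); first lia.
  exact: (U1_le_U2 A_gt0 A1 A1 n0).
split=> //.
have [q [s [nE sP]]] := divn_P n.
have prev a : a \in A -> a <= n -> exists p t,
    [/\ n - a = P * p + t, t < P,
      W A (n - a) = (if losing t then Player2 else Player1),
      U2 A (n - a) = upper (P * p + t - 1) &
      q = p /\ s = t + a \/ q = p.+1 /\ s + P = t + a].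
  move=> aA an; have a0 := mem_gt0 A_gt0 aA.
  have aP : a <= P by case: (mem_moves aA) => ->; lia.
  have [p [t [E tP qs]]] := sub_divn nE sP an aP.
  exists p, t; rewrite {2}E W_losing // -E; split=> //.
  by have [] := IH (n - a) ltac:(lia).
have Wn := W_losing q sP; rewrite -nE in Wn.
case Wn': (W A n); move: Wn; rewrite Wn'; case: ifP => // ls _.
  have [a aA [an Wa Ua]] := U1_attained_Player1 A_gt0 A1 Wn'.
  have [p [t [E tP WE UE qs]]] := prev a aA an.
  move: Wa; rewrite WE; case: ifP => // lt _.
  have [H1 H2 _] := upper_move aA sP tP qs.
  (* If one stone wins NIM, the minimizing [a] may be another move: residue [L] also allows [L].
     Equality then comes from two inequalities. *)
  have [s0|s0] := boolP (losing (s - 1) && (0 < s)); last first.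
    by rewrite Ua UE nE H2 //; right.
  apply/eqP; rewrite eqn_leq; apply/andP; split; last by rewrite Ua UE nE H1.
  have [p' [t' [E' t'P WE' UE' qs']]] := prev 1 A1 n0.
  have lt' : losing t'.
    by rewrite (_ : t' = s - 1); move: s0; rewrite /losing; lia.
  have [_ H3 _] := upper_move A1 sP t'P qs'.
  have -> : upper n = upper (P * p' + t' - 1) + 1.
    by rewrite {1}nE H3 //; left.
  rewrite -UE'; apply: (U1_le_Player1 A_gt0 A1 Wn' A1 n0).
  by rewrite WE' lt'.
have [a aA [an UaU2 Ua]] := U1_attained_Player2 A_gt0 A1 n0 Wn'.
have [p [t [E tP WE UE qs]]] := prev a aA an.
have [_ _ H] := upper_move aA sP tP qs.
rewrite Ua UE nE H // -E -nE -U2n -UaU2.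
have [|-> //] := IH (n - a); first by have := mem_gt0 A_gt0 aA; lia.
Qed.

(** * The upper class amounts over the even period 4L + 2, against the staircase *)

Lemma upper_period (q r : nat) : r < 2 * P ->
  upper (2 * P * q + r) = (6 * h + 4) * q +
    uphalf (r + (if r <= L then 0 else if r <= 3 * L + 1 then L else 2 * L)).
Proof.
move=> rP; have [rP1|Pr] := ltnP r P.
  rewrite (_ : 2 * P * q + r = P * (2 * q) + r); last lia.
  by rewrite upperE //; do 2?case: ifP => ?; lia.
rewrite (_ : 2 * P * q + r = P * (2 * q + 1) + (r - P)); last lia.
by rewrite upperE; last lia; do 3?case: ifP => ?; lia.
Qed.

Lemma upper_period_pred (q r : nat) : r < 2 * P ->
  upper (2 * P * q + r - 1) = (6 * h + 4) * q + uphalf (r - 1 +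
    (if r <= L + 1 then 0 else if r <= 3 * L + 2 then L else 2 * L)).
Proof.
move=> rP; case: r rP => [|r] rP; last first.
  rewrite -addnBA // subn1 /= upper_period; last lia.
  by do 4?case: ifP => ?; lia.
case: q => [|q].
  by rewrite !muln0 /upper mod0n div0n muln0.
rewrite (_ : _ - 1 = 2 * P * q + (2 * P - 1)) ?upper_period; try lia.
by rewrite /=; do 2?case: ifP => ?; lia.
Qed.

(** Reducing modulo [2 * P] keeps the parity of [n], and both amounts exceed half the pile by
    [L * q] plus a bounded term. Hence only steps next to [q] matter: [q - 1] or [q] for even piles,
    [q] or [q + 1] for odd ones. *)
Lemma mid_rich (n d e : nat) : upper n <= d -> e < upper (n - 1) -> mid n d e.
Proof.
have := divn_eq n (2 * P); set q := n %/ _; set r := n %% _.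
have rP : r < 2 * P by rewrite ltn_mod; lia.
rewrite mulnC => nE; have := upper_mono (leq_subr 1 n).
rewrite nE upper_period // upper_period_pred // {nE}.
have [[m rE]|[m rE]] := parity_cases r.
  rewrite (_ : 2 * P * q + r = 2 * (P * q + m)) ?mid_even; last lia.
  move=> le_pred ud eu; case: (ltnP e (P * q + m)) => em.
    by left; move: le_pred ud eu; do 4?case: ifP => ?; lia.
  right; case: (ltnP e (P * q + m + L * q)) => emq.
    case: q le_pred ud eu em emq => [|q]; first lia.
    by exists q; move: le_pred ud eu; do 4?case: ifP => ?; lia.
  by exists q; move: le_pred ud eu; do 4?case: ifP => ?; lia.
rewrite (_ : 2 * P * q + r = 2 * (P * q + m) + 1) ?mid_odd; last lia.
move=> le_pred ud eu; right.
case: (leqP e (P * q + m + h + L * q)) => emq.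
  by exists q; move: le_pred ud eu; do 4?case: ifP => ?; lia.
by exists q.+1; move: le_pred ud eu; do 4?case: ifP => ?; lia.
Qed.

Lemma mid_poor (n d e : nat) : d < upper n -> upper (n - 1) <= e -> ~ mid n d e.
Proof.
have := divn_eq n (2 * P); set q := n %/ _; set r := n %% _.
have rP : r < 2 * P by rewrite ltn_mod; lia.
rewrite mulnC => ->; rewrite upper_period // upper_period_pred //.
have [[m rE]|[m rE]] := parity_cases r.
  rewrite (_ : 2 * P * q + r = 2 * (P * q + m)) ?mid_even; last lia.
  move=> H1 H2 [|[k]]; move: H1 H2.
    by do 4?case: ifP => ?; lia.
  (* The bound on [d] keeps the step [k] low, and then its bound on [e] does not exceed [U2 n];
     comparing [k] with [q] and [q + 1] covers all residues. *)
  have := leq_mul_dichotomy k q; have := leq_mul_dichotomy q k.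
  have := leq_mul_dichotomy q.+1 k; have := leq_mul_dichotomy k q.+1.
  by do 4?case: ifP => ?; lia.
rewrite (_ : 2 * P * q + r = 2 * (P * q + m) + 1) ?mid_odd; last lia.
move=> H1 H2 [|[k]]; move: H1 H2.
  by do 4?case: ifP => ?; lia.
have := leq_mul_dichotomy k q; have := leq_mul_dichotomy q k.
have := leq_mul_dichotomy q.+1 k; have := leq_mul_dichotomy k q.+1.
by do 4?case: ifP => ?; lia.
Qed.

(** * The winner for middle class players *)

Lemma W_cash_mid_nim (n d e : nat) : d < U1 A n ->
  W_cash A n d e = if `[< mid n d e >] then Player1 else Player2.
Proof.
move=> dU; have A1 : 1 \in A by rewrite mem_head.
have U2_pred m : 0 < m -> U2 A m = U1 A (m - 1).
  by have [_ ->] := U_upper m; have [-> _] := U_upper (m - 1).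
have poor m x y : x < U1 A m -> U2 A m <= y -> ~ mid m x y.
  by have [-> ->] := U_upper m; exact: mid_poor.
have rich m x y : U1 A m <= x -> y < U2 A m -> mid m x y.
  by have [-> ->] := U_upper m; exact: mid_rich.
have := W_cash_mid A_gt0 A1 U2_pred mid_move1 mid_move poor rich n d e.
rewrite leqNgt dU /=.
by case: asboolP => [Mn [_ ->]//|Nm [H _]]; apply/neq_player1 => /H.
Qed.

(** A middle class [e] voids the first disjunct of [mid], and the bound on [e] grows with the step,
    so the highest step that [d] reaches decides. *)
Lemma mid_even_lt (n d e k : nat) : ~~ odd n -> M2 n <= e ->
  M1 n + h + L * k <= d < M1 n + h + L * (k + 1) ->
  mid n d e <-> e < M2 n + L * (k + 1).
Proof.
move=> n_even eM dk; rewrite /mid (negbTE n_even); split=> [[|[l]]|ek].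
- lia.
- have := leq_mul_dichotomy l k; lia.
- by right; exists k; lia.
Qed.

Lemma mid_even_poor (n d e : nat) : ~~ odd n -> M2 n <= e ->
  d < M1 n + h -> ~ mid n d e.
Proof.
by move=> n_even eM dM; rewrite /mid (negbTE n_even) => -[|[l]]; lia.
Qed.

Lemma mid_odd_lt (n d e k : nat) : odd n -> M2 n <= e ->
  M1 n + L * k <= d < M1 n + L * (k + 1) ->
  mid n d e <-> e < M2 n + h + L * k.
Proof.
move=> n_odd eM dk; rewrite /mid n_odd; split=> [[|[l]]|ek].
- lia.
- have := leq_mul_dichotomy l k; lia.
- by right; exists k; lia.
Qed.

(** Written with [n] in place of [r], the closed forms become comparable with [M1 n] and [M2 n]. *)
Lemma U_period (n q r : nat) : n = 2 * P * q + r -> r < 2 * P ->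
  U1 A n = L * q + uphalf (n +
    (if r <= L then 0 else if r <= 3 * L + 1 then L else 2 * L)) /\
  U2 A n = L * q + (n +
    (if r <= L + 1 then 0 else if r <= 3 * L + 2 then L else 2 * L))./2.
Proof.
move=> nE rP; have [-> ->] := U_upper n.
rewrite nE upper_period // upper_period_pred //.
move: (if r <= L then _ else _) => i.
split; first lia.
case: r {nE} rP => [|r] rP; first by rewrite /=; lia.
move: (if r.+1 <= L + 1 then _ else _) => j; lia.
Qed.

End Middle.

(** * The six residue classes *)

Lemma M1_half (n : nat) : M1 n = n./2.+1.
Proof. by rewrite /M1; case: ifP; lia. Qed.

Lemma M2_uphalf (n : nat) : M2 n = uphalf n.
Proof. by rewrite /M2; case: ifP; lia. Qed.

Lemma mem_progression2 (a b x : nat) :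
  (x \in progression2 a b) = [&& a <= x, x <= b & ~~ odd (x - a)].
Proof. by rewrite mem_filter mem_index_iota ltnS andbC andbA. Qed.

Theorem theorem6p7 (L n d e : nat) (hL : odd L)
    (hd : M1 n <= d < U1 [:: 1; L; L + 1] n)
    (he : M2 n <= e < U2 [:: 1; L; L + 1] n) :
  let A := [:: 1; L; L + 1] in
  let r := n %% (4 * L + 2) in
  let h := (L - 1) %/ 2 in
  (r \in progression2 0 (L - 1) ++ progression2 (3 * L + 3) (4 * L) ->
    [/\ d < M1 n + h -> W_cash A n d e = Player2,
        forall k : nat, M1 n + h + L * k <= d < M1 n + h + L * (k + 1) ->
          (e < M2 n + L * (k + 1) -> W_cash A n d e = Player1) /\
          (e >= M2 n + L * (k + 1) -> W_cash A n d e = Player2)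
      & d >= U1 A n - h -> W_cash A n d e = Player1]) /\
  (r \in progression2 1 L ++ progression2 (3 * L + 4) (4 * L + 1) ->
    (forall k : nat, M1 n + L * k <= d < M1 n + L * (k + 1) ->
      (e < M2 n + h + L * k -> W_cash A n d e = Player1) /\
      (e >= M2 n + h + L * k -> W_cash A n d e = Player2)) /\
    (d >= U1 A n - L ->
      (e < U2 A n - h -> W_cash A n d e = Player1) /\
      (e >= U2 A n - h -> W_cash A n d e = Player2))) /\
  (r = L + 1 ->
    [/\ d < M1 n + h -> W_cash A n d e = Player2,
        forall k : nat, M1 n + h + L * k <= d < M1 n + h + L * (k + 1) ->
          (e < M2 n + L * (k + 1) -> W_cash A n d e = Player1) /\
          (e >= M2 n + L * (k + 1) -> W_cash A n d e = Player2)
      & d >= U1 A n - L -> W_cash A n d e = Player1]) /\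
  (r \in progression2 (L + 2) (3 * L) ->
    (forall k : nat, M1 n + L * k <= d < M1 n + L * (k + 1) ->
      (e < M2 n + h + L * k -> W_cash A n d e = Player1) /\
      (e >= M2 n + h + L * k -> W_cash A n d e = Player2)) /\
    (d >= U1 A n - h -> W_cash A n d e = Player1)) /\
  (r \in progression2 (L + 3) (3 * L + 1) ->
    [/\ d < M1 n + h -> W_cash A n d e = Player2,
        forall k : nat, M1 n + h + L * k <= d < M1 n + h + L * (k + 1) ->
          (e < M2 n + L * (k + 1) -> W_cash A n d e = Player1) /\
          (e >= M2 n + L * (k + 1) -> W_cash A n d e = Player2)
      & d >= U1 A n - L ->
          (e < U2 A n - h -> W_cash A n d e = Player1) /\
          (e >= U2 A n - h -> W_cash A n d e = Player2)]) /\
  (r = 3 * L + 2 ->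
    (forall k : nat, M1 n + L * k <= d < M1 n + L * (k + 1) ->
      (e < M2 n + h + L * k -> W_cash A n d e = Player1) /\
      (e >= M2 n + h + L * k -> W_cash A n d e = Player2)) /\
    (d >= U1 A n - L -> W_cash A n d e = Player1)).
Proof.
move=> A r h; have LE : L = 2 * h + 1 by rewrite /h; lia.
move: hd he => /andP[dM dU] /andP[eM eU].
have win : mid L h n d e -> W_cash A n d e = Player1.
  by rewrite (W_cash_mid_nim LE) // => H; rewrite asboolT.
have lose : ~ mid L h n d e -> W_cash A n d e = Player2.
  by rewrite (W_cash_mid_nim LE) // => H; rewrite asboolF.
have even_poor : ~~ odd n -> d < M1 n + h -> W_cash A n d e = Player2.
  by move=> n_even dh; apply: lose; exact: mid_even_poor.
have even_mid : ~~ odd n -> forall k : nat,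
    M1 n + h + L * k <= d < M1 n + h + L * (k + 1) ->
    (e < M2 n + L * (k + 1) -> W_cash A n d e = Player1) /\
    (e >= M2 n + L * (k + 1) -> W_cash A n d e = Player2).
  move=> n_even k dk; have E := mid_even_lt LE n_even eM dk.
  by split=> H; [apply/win/E|apply: lose => /E; rewrite ltnNge H].
have odd_mid : odd n -> forall k : nat,
    M1 n + L * k <= d < M1 n + L * (k + 1) ->
    (e < M2 n + h + L * k -> W_cash A n d e = Player1) /\
    (e >= M2 n + h + L * k -> W_cash A n d e = Player2).
  move=> n_odd k dk; have E := mid_odd_lt LE n_odd eM dk.
  by split=> H; [apply/win/E|apply: lose => /E; rewrite ltnNge H].
(* For the clauses near [U1 n], where [e < U2 n] already puts [e] under the bound of the top step,
   no upper bound on [d] is needed. *)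
have even_win k : ~~ odd n -> M1 n + h + L * k <= d ->
    e < M2 n + L * (k + 1) -> W_cash A n d e = Player1.
  by move=> /negbTE no dk ek; apply: win; right; exists k; rewrite no dk.
have odd_win k : odd n -> M1 n + L * k <= d ->
    e < M2 n + h + L * k -> W_cash A n d e = Player1.
  by move=> no dk ek; apply: win; right; exists k; rewrite no dk.
have rP : r < 2 * (4 * h + 3) by have := ltn_pmod n (ltn0Sn (4 * L + 1)); lia.
have := divn_eq n (4 * L + 2); rewrite -/r; move: (n %/ (4 * L + 2)) => q nE.
have {}nE : n = 2 * (4 * h + 3) * q + r by lia.
have odd_nr : odd n = odd r by lia.
have [U1n U2n] := U_period LE nE rP.
rewrite -/A in U1n U2n dU eU *.
have M1E := M1_half n; have M2E := M2_uphalf n.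
rewrite !mem_cat !mem_progression2.
clear win lose nE; clearbody r h; clear hL rP.
split=> [rA|].
  have n_even : ~~ odd n by lia.
  split; [exact: even_poor|exact: even_mid|move=> dh].
  have [rL|Lr] := leqP r L.
    have U1E : U1 A n = M2 n + L * q by move: U1n; rewrite rL; lia.
    have U2E : U2 A n = M2 n + L * q by move: U2n; rewrite ifT; lia.
    (* For [q = 0] the amount [U1 n] is [M2 n], so nobody is middle class; otherwise the top step is
       the predecessor of [q]. *)
    case: q U1E U2E {U1n U2n} => [|q] U1E U2E; first lia.
    by apply: (even_win q) => //; lia.
  have U1E : U1 A n = M2 n + L * q + L by move: U1n; rewrite !ifF; lia.
  have U2E : U2 A n = M2 n + L * q + L by move: U2n; rewrite !ifF; lia.
  by apply: (even_win q) => //; lia.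
split=> [rA|].
  have n_odd : odd n by lia.
  split=> [|dL]; first exact: odd_mid.
  have [rL|Lr] := leqP r L.
    have U1E : U1 A n = M1 n + L * q by move: U1n; rewrite rL; lia.
    have U2E : U2 A n + 1 = M1 n + L * q by move: U2n; rewrite ifT; lia.
    case: q U1E U2E {U1n U2n} => [|q] U1E U2E; first lia.
    have [|win lose] := odd_mid n_odd q; first lia.
    by split=> ?; [apply: win|apply: lose]; lia.
  have U1E : U1 A n = M1 n + L * q + L by move: U1n; rewrite !ifF; lia.
  have U2E : U2 A n + 1 = M1 n + L * q + L by move: U2n; rewrite !ifF; lia.
  have [|win lose] := odd_mid n_odd q; first lia.
  by split=> ?; [apply: win|apply: lose]; lia.
split=> [rA|].
  have n_even : ~~ odd n by lia.
  split; [exact: even_poor|exact: even_mid|move=> dL].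
  have U1E : U1 A n = M1 n + L * q + h by move: U1n; rewrite ifF ?ifT; lia.
  have U2E : U2 A n = M2 n + L * q by move: U2n; rewrite ifT; lia.
  (* For [q = 0] the second player's middle class is empty, as [U2 n = M2 n]. *)
  case: q U1E U2E {U1n U2n} => [|q] U1E U2E; first lia.
  by apply: (even_win q) => //; lia.
split=> [rA|].
  have n_odd : odd n by lia.
  split=> [|dh]; first exact: odd_mid.
  have U1E : U1 A n = M1 n + L * q + h by move: U1n; rewrite ifF ?ifT; lia.
  have U2E : U2 A n = M2 n + L * q + h by move: U2n; rewrite ifF ?ifT; lia.
  by apply: (odd_win q) => //; lia.
split=> [rA|rE].
  have n_even : ~~ odd n by lia.
  split; [exact: even_poor|exact: even_mid|move=> dL].
  have U1E : U1 A n = M1 n + L * q + h by move: U1n; rewrite ifF ?ifT; lia.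
  have U2E : U2 A n = M2 n + L * q + h by move: U2n; rewrite ifF ?ifT; lia.
  (* For [q = 0] the middle class is not empty, but [U1 n = M1 n + h] leaves the mover below the
     first step. *)
  case: q U1E U2E {U1n U2n} => [|q] U1E U2E.
    by split=> ?; [lia|apply: even_poor => //; lia].
  have [|win lose] := even_mid n_even q; first lia.
  by split=> ?; [apply: win|apply: lose]; lia.
have n_odd : odd n by lia.
split=> [|dL]; first exact: odd_mid.
have U1E : U1 A n = M1 n + L * q + L by move: U1n; rewrite !ifF; lia.
have U2E : U2 A n = M2 n + L * q + h by move: U2n; rewrite ifF ?ifT; lia.
by apply: (odd_win q) => //; lia.
Qed.
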